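(* Let $\mathcal{M}$ be a finite MDP in which distinct states have pairwise disjoint sets of enabled actions. Then for each memoryless randomized scheduler $\mathfrak{S}$ for the MEC-quotient of $\mathcal{M}$ with $\mathfrak{S}(s_{\mathcal{E}})(\tau)\in\{0,1\}$ for each maximal end component $\mathcal{E}$ of $\mathcal{M}$, there is a memoryless randomized scheduler $\mathfrak{T}$ for $\mathcal{M}$ such that every action $\alpha$ of $\mathcal{M}$ that does not belong to a maximal end component of $\mathcal{M}$ has the same expected frequency under $\mathfrak{S}$ (in the MEC-quotient) and under $\mathfrak{T}$ (in $\mathcal{M}$).
   Context: An MDP $\mathcal{M}=(S,\mathit{Act},P,\mathsf{init})$ has finite $S,\mathit{Act}$, initial state $\mathsf{init}$ and $P:S\times\mathit{Act}\times S\to[0,1]$ with $\sum_tP(s,\alpha,t)\in\{0,1\}$; $\alpha$ is enabled in $s$ if the sum is $1$; $s$ is terminal if no action is enabled. An end component is a strongly connected sub-MDP with at least one state-action pair; a maximal end component (MEC) is one not properly contained in another; since enabled action sets are disjoint, a MEC is identified with its set of actions. The expected frequency of action $\alpha$ under a scheduler is the expected number of times $\alpha$ is taken along a maximal path from the initial state. MEC-quotient: let $\mathcal{E}_1,\dots,\mathcal{E}_k$ be the MECs with state sets $U_1,\dots,U_k$, $U=\bigcup U_i$. The MEC-quotient has states $(S\setminus U)\cup\{s_{\mathcal{E}_1},\dots,s_{\mathcal{E}_k},\bot\}$ (fresh states), actions $\mathit{Act}\cup\{\tau\}$ ($\tau$ fresh), and with $\iota(s)=s$ for $s\notin U$, $\iota(u)=s_{\mathcal{E}_i}$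 for $u\in U_i$, initial state $\iota(\mathsf{init})$. A state $s\in S\setminus U$ keeps its enabled actions with $P'(s,\alpha,s')=P(s,\alpha,\iota^{-1}(s'))$. State $s_{\mathcal{E}_i}$ has enabled actions $\bigcup_{u\in U_i}(\mathit{Act}(u)\setminus\mathcal{E}_i)\cup\{\tau\}$, with $P'(s_{\mathcal{E}_i},\tau,\bot)=1$ and, for $u\in U_i$ and $\alpha\in\mathit{Act}(u)\setminus\mathcal{E}_i$, $P'(s_{\mathcal{E}_i},\alpha,s')=P(u,\alpha,\iota^{-1}(s'))$. The state $\bot$ is terminal. *)

(* Defs.v *)
From HB Require Import structures.
From mathcomp Require Import all_boot all_order all_algebra.
From mathcomp Require Import all_classical all_reals all_analysis.

Set Implicit Arguments.
Unset Strict Implicit.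
Unset Printing Implicit Defensive.

Import Order.TTheory GRing.Theory Num.Theory.
Import numFieldNormedType.Exports.

Local Open Scope classical_set_scope.
Local Open Scope ring_scope.

(* Path measure of a finite Markov chain on infinite sequences, obtained by
   extending the premeasure on the algebra of cylinder sets. *)

Definition is_distr (R : realType) (F : finType) (p : F -> R) :=
  (forall x, 0 <= p x) /\ \sum_x p x = 1.

Record markov_chain (R : realType) (F : finType) := MarkovChain {
  mc_init : F -> R;
  mc_step : F -> F -> R;
  mc_initP : is_distr mc_init;
  mc_stepP : forall x, is_distr (mc_step x) }.

(* [x0] only serves to make the type pointed. *)
Definition traj (F : finType) (x0 : F) : Type := nat -> F.

HB.instance Definition _ (F : finType) (x0 : F) := gen_eqMixin (traj x0).
HB.instance Definition _ (F : finType) (x0 : F) := gen_choiceMixin (traj x0).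
HB.instance Definition _ (F : finType) (x0 : F) :=
  isPointed.Build (traj x0) (fun=> x0).

Section cylinders.
Variables (F : finType) (x0 : F).
Implicit Types (A B : set (traj x0)) (w : traj x0).

Definition depends_on n A :=
  forall w w', (forall i, (i < n)%N -> w i = w' i) -> A w -> A w'.

Definition cylinder A := exists n, depends_on n A.

Lemma depends_onW m n A : (m <= n)%N -> depends_on m A -> depends_on n A.
Proof.
by move=> mn dA w w' e; apply: dA => i im; apply: e; exact: leq_trans im mn.
Qed.

Lemma cylinder0 : cylinder set0.
Proof. by exists 0%N. Qed.

Lemma cylinderC A : cylinder A -> cylinder (~` A).
Proof.
move=> [n dA]; exists n => w w' e nA Aw'; apply: nA.
by apply: dA Aw' => i /e.
Qed.

Lemma cylinderU A B : cylinder A -> cylinder B -> cylinder (A `|` B).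
Proof.
move=> [m dA] [n dB]; exists (maxn m n) => w w' e [Aw|Bw].
  by left; apply: (depends_onW (leq_maxl m n) dA) Aw.
by right; apply: (depends_onW (leq_maxr m n) dB) Bw.
Qed.

HB.instance Definition _ :=
  @isAlgebraOfSets.Build default_measure_display (traj x0) cylinder
    cylinder0 cylinderU cylinderC.

Definition tcons (y : F) w : traj x0 := fun i => if i is i'.+1 then w i' else y.

Lemma depends_on_tcons n y A :
  depends_on n.+1 A -> depends_on n [set w | A (tcons y w)].
Proof. by move=> dA w w' e; apply: dA => -[|i]//= /e. Qed.

Lemma cylinder_koenig (G : nat -> set (traj x0)) :
  (forall n, cylinder (G n)) -> (forall n, G n !=set0) ->
  (forall m n, (m <= n)%N -> G n `<=` G m) -> exists w, forall n, G n w.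
Proof.
move=> cG nG dG.
pose ext (h : seq F) := forall n, exists2 w, G n w &
  forall i, (i < size h)%N -> w i = nth x0 h i.
have step (h : seq F) : ext h -> exists y, ext (rcons h y).
  move=> eh; apply: contrapT => /forallNP noy.
  have {}noy : forall y, exists n, forall w, G n w ->
      ~ (forall i, (i < size (rcons h y))%N -> w i = nth x0 (rcons h y) i).
    move=> y; have /existsNP[n nw] := noy y; exists n => w Gw e.
    by apply: nw; exists w.
  have [f fP] := choice noy.
  have [w Gw we] := eh (\max_y f y).
  apply: (fP (w (size h)) w).
    by apply: dG Gw; exact: leq_bigmax.
  move=> i; rewrite size_rcons ltnS nth_rcons leq_eqVlt => /orP[/eqP ->|ih].
    by rewrite ltnn eqxx.
  by rewrite ih we.
pose g (k : {h | ext h}) : {h | ext h} :=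
  exist ext _ (svalP (cid (step _ (svalP k)))).
have gP k : exists y, sval (g k) = rcons (sval k) y.
  by exists (sval (cid (step _ (svalP k)))).
have ext0 : ext [::] by move=> n; have [w Gw] := nG n; exists w.
pose h n := sval (iter n g (exist _ _ ext0)).
have hS n : exists y, h n.+1 = rcons (h n) y by exact: gP.
have sh n : size (h n) = n.
  by elim: n => // n IH; have [y ->] := hS n; rewrite size_rcons IH.
have hn m n i : (i < m)%N -> (m <= n)%N -> nth x0 (h n) i = nth x0 (h m) i.
  move=> im; elim: n => [|n IH]; first by rewrite leqn0 => /eqP ->.
  rewrite leq_eqVlt => /orP[/eqP -> //|]; rewrite ltnS => mn.
  have [y ->] := hS n; rewrite nth_rcons sh (leq_trans im mn).
  exact: IH.
exists (fun i => nth x0 (h i.+1) i) => n.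
have [k dk] := cG n.
have [w Gw we] := svalP (iter k g (exist _ _ ext0)) n.
apply: dk Gw => i ik; rewrite we; last by rewrite -/(h k) sh.
by rewrite -/(h k) (hn i.+1).
Qed.

End cylinders.

Section chain_premeasure.
Variables (R : realType) (F : finType) (x0 : F) (C : markov_chain R F).
Implicit Types (A B : set (traj x0)) (d : F -> R) (n : nat).

(* Probability of [A] when the first [n] states are drawn, the first one from
   [d] and the others from the transition function; exact as soon as [A]
   depends on the first [n] states only. *)
Fixpoint prefix_prob n d A : R :=
  if n is n'.+1 then
    \sum_y d y * prefix_prob n' (mc_step C y) [set w | A (tcons y w)]
  else \1_A point.

Lemma prefix_prob_rec n d A : prefix_prob n.+1 d A =
  \sum_y d y * prefix_prob n (mc_step C y) [set w | A (tcons y w)].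
Proof. by []. Qed.

Lemma prefix_prob_ge0 n d A : is_distr d -> 0 <= prefix_prob n d A.
Proof.
elim: n d A => [|n IH] d A [d0 _] /=; first by rewrite indicE.
by apply: sumr_ge0 => y _; rewrite mulr_ge0// IH//; exact: mc_stepP.
Qed.

Lemma prefix_prob0 n d : prefix_prob n d set0 = 0.
Proof.
elim: n d => [|n IH] d /=; first by rewrite indic0.
by rewrite big1// => y _; rewrite (_ : [set w | _] = set0) ?IH ?mulr0.
Qed.

Lemma prefix_probT n d : is_distr d -> prefix_prob n d setT = 1.
Proof.
elim: n d => [|n IH] d [d0 d1] /=; first by rewrite indicT.
rewrite -d1; apply: eq_bigr => y _.
rewrite (_ : [set w | _] = setT) ?IH ?mulr1//; first exact: mc_stepP.
Qed.

Lemma prefix_probU n d A B : A `&` B = set0 ->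
  prefix_prob n d (A `|` B) = prefix_prob n d A + prefix_prob n d B.
Proof.
elim: n d A B => [|n IH] d A B AB /=.
  rewrite !indicE in_setU.
  case: (boolP (point \in A)) => pA; case: (boolP (point \in B)) => pB //=;
    rewrite ?addr0 ?add0r//.
  have : (A `&` B) point by split; [exact: set_mem pA|exact: set_mem pB].
  by rewrite AB.
rewrite -big_split; apply: eq_bigr => y _ /=; rewrite -mulrDr; congr (_ * _).
rewrite -IH//; apply/seteqP; split => w //= [Aw Bw].
by have : (A `&` B) (tcons y w) by []; rewrite AB.
Qed.

Lemma prefix_probS n d A : is_distr d -> depends_on n A ->
  prefix_prob n.+1 d A = prefix_prob n d A.
Proof.
elim: n d A => [|n IH] d A dd dA.
  rewrite /= -[RHS]mul1r -dd.2 mulr_suml; apply: eq_bigr => y _.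
  rewrite !indicE; congr (_ * (nat_of_bool _)%:R).
  by apply/idP/idP => /set_mem h; apply/mem_set; apply: dA h.
rewrite prefix_prob_rec [RHS]prefix_prob_rec; apply: eq_bigr => y _; congr (_ * _); apply: IH; first exact: mc_stepP.
exact: depends_on_tcons.
Qed.

Lemma prefix_prob_stable m n d A : is_distr d -> depends_on m A ->
  (m <= n)%N -> prefix_prob n d A = prefix_prob m d A.
Proof.
move=> dd dA; elim: n => [|n IH]; first by rewrite leqn0 => /eqP ->.
rewrite leq_eqVlt => /orP[/eqP <- //|]; rewrite ltnS => mn.
by rewrite prefix_probS ?IH//; exact: depends_onW dA.
Qed.

Definition cylinder_prob A : \bar R :=
  (prefix_prob (xget 0%N [set n | depends_on n A]) (mc_init C) A)%:E.

Lemma cylinder_probE n A : depends_on n A ->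
  cylinder_prob A = (prefix_prob n (mc_init C) A)%:E.
Proof.
move=> dA; rewrite /cylinder_prob; congr _%:E.
have /= := xgetPex 0%N (ex_intro _ n dA : exists n, [set n | depends_on n A] n).
set m := xget _ _ => dm.
have ic := mc_initP C.
rewrite -(prefix_prob_stable ic dm (leq_maxl m n)).
by rewrite (prefix_prob_stable ic dA (leq_maxr m n)).
Qed.

Lemma cylinder_prob0 : cylinder_prob set0 = 0%E.
Proof. by rewrite /cylinder_prob prefix_prob0. Qed.

Lemma cylinder_prob_ge0 A : (0 <= cylinder_prob A)%E.
Proof. by rewrite lee_fin prefix_prob_ge0//; exact: mc_initP. Qed.

Lemma cylinder_probT : cylinder_prob setT = 1%E.
Proof. by rewrite /cylinder_prob prefix_probT//; exact: mc_initP. Qed.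

Lemma cylinder_probU A B : cylinder A -> cylinder B -> A `&` B = set0 ->
  cylinder_prob (A `|` B) = (cylinder_prob A + cylinder_prob B)%E.
Proof.
move=> [m dA] [n dB] AB.
have {}dA := depends_onW (leq_maxl m n) dA.
have {}dB := depends_onW (leq_maxr m n) dB.
rewrite (cylinder_probE dA) (cylinder_probE dB) (@cylinder_probE (maxn m n)).
  by rewrite prefix_probU.
by move=> w w' e [/(dA _ _ e)|/(dB _ _ e)]; [left|right].
Qed.

Lemma cylinder_prob_sigma_additive :
  semi_sigma_additive (cylinder_prob : set (traj x0) -> \bar R).
Proof.
move=> E mE tE mUE.
pose H n := \big[setU/set0]_(i < n) E i.
have cH n : cylinder (H n).
  apply: (big_ind (@cylinder F x0)) => [||i _]; [exact: cylinder0|exact: cylinderU|exact: mE].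
pose G n := (\bigcup_i E i) `\` H n.
have cG n : cylinder (G n).
  by rewrite /G setDE setIC -[X in cylinder X]setCK setCI setCK;
     apply/cylinderC/cylinderU => //; exact: cylinderC.
have [N GN] : exists N, G N = set0.
  apply: contrapT => /forallNP nG.
  have [] := @cylinder_koenig _ _ G cG.
  - by move=> n; apply/set0P/eqP; exact: nG.
  - move=> m n mn w [Uw nHw]; split => //; apply: contra_not nHw.
    rewrite /H -!bigcup_mkord => -[i /= im Eiw]; exists i => //=.
    exact: leq_trans im mn.
  - move=> w Gw; have [[i _ Eiw] _] := Gw 0%N.
    by have [_] := Gw i.+1; apply; rewrite /H big_ord_recr; right.
have HE n : cylinder_prob (H n) = (\sum_(0 <= i < n) cylinder_prob (E i))%E.
  elim: n => [|n IH]; first by rewrite /H big_ord0 big_geq// cylinder_prob0.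
  rewrite big_nat_recr//= -IH /H big_ord_recr/= cylinder_probU//.
  - exact: cH.
  - exact: mE.
  - apply/seteqP; split => // w [Hw Ew].
    move: Hw; rewrite -bigcup_mkord => -[i /= ni Eiw].
    by move: ni; rewrite (tE i n I I) ?ltnn//; exists w.
apply: cvg_near_cst; exists N => // n /= Nn.
rewrite -HE; congr (cylinder_prob _); apply/seteqP; split.
  by rewrite /H -bigcup_mkord => w [i _ Eiw]; exists i.
move=> w Uw; apply: contrapT => nHw.
have : G N w.
  split => //; apply: contra_not nHw.
  rewrite /H -!bigcup_mkord => -[i /= iN Eiw]; exists i => //=.
  exact: leq_trans iN Nn.
by rewrite GN.
Qed.

HB.instance Definition _ := isMeasure.Build _ _ _ cylinder_prob
  cylinder_prob0 cylinder_prob_ge0 cylinder_prob_sigma_additive.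

End chain_premeasure.

Definition traj_space (F : finType) (x0 : F) :=
  g_sigma_algebraType (@measurable _ (traj x0)).

Section chain_measure.
Variables (R : realType) (F : finType) (x0 : F) (C : markov_chain R F).

Definition chain_measure : set (traj_space x0) -> \bar R :=
  measure_extension (@cylinder_prob R F x0 C).

HB.instance Definition _ := Measure.on chain_measure.

Lemma chain_measure_cylinder (A : set (traj x0)) : cylinder A ->
  chain_measure A = cylinder_prob C A.
Proof.
by move=> mA; rewrite /chain_measure /measure_extension measurable_mu_extE.
Qed.

Lemma chain_measureT : chain_measure setT = 1%E.
Proof.
by rewrite chain_measure_cylinder ?cylinder_probT//; exists 0%N.
Qed.

HB.instance Definition _ :=
  Measure_isProbability.Build _ _ _ chain_measure chain_measureT.

Lemma chain_measure_prefix (f : nat -> F) n :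
  chain_measure [set w : traj x0 | forall i, (i <= n)%N -> w i = f i] =
  (mc_init C (f 0%N) * \prod_(i < n) mc_step C (f i) (f i.+1))%:E.
Proof.
have dA : depends_on n.+1 [set w : traj x0 | forall i, (i <= n)%N -> w i = f i].
  by move=> w w' e Aw i ni; rewrite -e ?Aw.
rewrite chain_measure_cylinder; last by exists n.+1.
rewrite (cylinder_probE C dA); congr _%:E; move: (mc_init C) {dA}.
elim: n f => [|n IH] f d.
  rewrite /= big_ord0 mulr1 (bigD1 (f 0%N))//= indicE mem_set ?mulr1; last first.
    by case.
  rewrite big1 ?addr0// => y yf; rewrite indicE memNset ?mulr0//= => /(_ 0%N erefl).
  by move/eqP; apply/negP.
rewrite [LHS]prefix_prob_rec (bigD1 (f 0%N)) //.
rewrite (_ : [set w | _] =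
    [set w : traj x0 | forall i, (i <= n)%N -> w i = f i.+1]); last first.
  apply/seteqP; split => w /= h; first by move=> i ni; exact: (h i.+1).
  by case=> // i; rewrite ltnS => /h.
rewrite (IH (fun i => f i.+1)) [in RHS]big_ord_recl.
rewrite [X in _ X = _](_ : _ = 0); first by rewrite /= addr0.
apply: big1 => y yf.
rewrite (_ : [set w | _] = set0); first by rewrite prefix_prob0 mulr0.
apply/seteqP; split => // w /(_ 0%N erefl) /= e.
by move: yf; rewrite e eqxx.
Qed.

End chain_measure.

Record mdp (R : realType) (S A : finType) := MDP {
  init : S;
  trans : S -> A -> S -> R;
  trans01 : forall s a t, 0 <= trans s a t <= 1;
  trans_sum : forall s a,
    \sum_t trans s a t = 0 \/ \sum_t trans s a t = 1 }.

Section mdp_defs.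
Variables (R : realType) (S A : finType) (M : mdp R S A).

Definition enabled (s : S) (a : A) : bool := \sum_t trans M s a t == 1.

Definition terminal (s : S) : bool := [forall a, ~~ enabled s a].

Definition disjoint_actions : Prop :=
  forall s t a, enabled s a -> enabled t a -> s = t.

(* Memoryless randomized scheduler. A terminal state enables no action, so that
   [sched_enabled] makes [sched] vanish there. *)
Record scheduler := Scheduler {
  sched :> S -> A -> R;
  sched_ge0 : forall s a, 0 <= sched s a;
  sched_enabled : forall s a, ~~ enabled s a -> sched s a = 0;
  sched_sum : forall s, ~~ terminal s -> \sum_a sched s a = 1 }.

(* A sub-MDP is a pair (states, state-action pairs). *)
Definition submdp (E : {set S} * {set S * A}) : bool :=
  (E.1 != finset.set0) &&
  [forall s, forall a, ((s, a) \in E.2) ==>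
     [&& s \in E.1, enabled s a &
         [forall t, (0 < trans M s a t) ==> (t \in E.1)]]].

Definition submdp_edge (E : {set S} * {set S * A}) : rel S :=
  [rel s t | [exists a, ((s, a) \in E.2) && (0 < trans M s a t)]].

Definition end_component (E : {set S} * {set S * A}) : bool :=
  [&& submdp E,
      [forall s in E.1, forall t in E.1, connect (submdp_edge E) s t] &
      E.2 != finset.set0].

Definition max_end_component (E : {set S} * {set S * A}) : bool :=
  end_component E &&
  [forall D : {set S} * {set S * A},
     [&& end_component D, E.1 \subset D.1 & E.2 \subset D.2] ==> (D == E)].

Definition mec := {E : {set S} * {set S * A} | max_end_component E}.

HB.instance Definition _ := Finite.on mec.

Definition mec_states (E : mec) : {set S} := (sval E).1.

Definition mec_pairs (E : mec) : {set S * A} := (sval E).2.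

Definition mec_actions (E : mec) : {set A} :=
  [set a | [exists s, (s, a) \in mec_pairs E]]%SET.

Definition in_mec (s : S) : bool := [exists E : mec, s \in mec_states E].

End mdp_defs.

Section mec_quotient.
Variables (R : realType) (S A : finType) (M : mdp R S A).

Definition quot_state : Type := option ({s : S | ~~ in_mec M s} + mec M).

HB.instance Definition _ := Finite.on quot_state.

Definition q_outside (s : {s : S | ~~ in_mec M s}) : quot_state := Some (inl s).
Definition q_mec (E : mec M) : quot_state := Some (inr E).
Definition q_bot : quot_state := None.

(* The last case does not occur: a state for which [insub] fails lies in a
   MEC. *)
Definition iota (s : S) : quot_state :=
  match insub s, [pick E : mec M | s \in mec_states E] with
  | Some x, _ => q_outside x
  | None, Some E => q_mec E
  | None, None => q_bot
  end.

Definition trans_iota (s : S) (a : A) (q : quot_state) : R :=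
  \sum_(t | iota t == q) trans M s a t.

(* The action [None] is tau. When the enabled sets are disjoint, at most one
   state [u] qualifies in the [pick]. *)
Definition quot_trans (q : quot_state) (b : option A) (q' : quot_state) : R :=
  match q, b with
  | Some (inl s), Some a => trans_iota (sval s) a q'
  | Some (inr E), Some a =>
      if [pick u in mec_states E | enabled M u a & (u, a) \notin mec_pairs E]
        is Some u then trans_iota u a q' else 0
  | Some (inr _), None => (q' == q_bot)%:R
  | _, _ => 0
  end.

Lemma trans_iota_ge0 s a q : 0 <= trans_iota s a q.
Proof. by apply: sumr_ge0 => t _; case/andP: (trans01 M s a t). Qed.

Lemma trans_iota_sum s a : \sum_q trans_iota s a q = \sum_t trans M s a t.
Proof. by rewrite [RHS](partition_big iota xpredT). Qed.

Lemma quot_trans_ge0 q b q' : 0 <= quot_trans q b q'.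
Proof.
case: q b => [[s|E]|] [a|] //=; first exact: trans_iota_ge0.
by case: pickP => // u _; exact: trans_iota_ge0.
Qed.

Lemma quot_trans_sum q b :
  \sum_q' quot_trans q b q' = 0 \/ \sum_q' quot_trans q b q' = 1.
Proof.
case: q b => [[s|E]|] [a|] /=; do ?[by left; rewrite big1].
- by rewrite trans_iota_sum; exact: trans_sum.
- case: pickP => [u _|_]; last by left; rewrite big1.
  by rewrite trans_iota_sum; exact: trans_sum.
- right; rewrite (bigD1 q_bot) // eqxx big1 => [|q /negbTE ->] //; exact: addr0.
Qed.

Lemma quot_trans01 q b q' : 0 <= quot_trans q b q' <= 1.
Proof.
rewrite quot_trans_ge0 /=.
have : quot_trans q b q' <= \sum_x quot_trans q b x.
  rewrite (bigD1 q')//= lerDl; apply: sumr_ge0 => x _.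
  exact: quot_trans_ge0.
by case: (quot_trans_sum q b) => -> // /le_trans; apply.
Qed.

Definition mec_quotient : mdp R quot_state (option A) :=
  MDP (iota (init M)) quot_trans01 quot_trans_sum.

End mec_quotient.

(* A maximal path s0 a0 s1 a1 ... is encoded as the sequence
   (s0, Some a0), (s1, Some a1), ...; a finite one ending in the terminal state
   s is continued by (s, None), (s, None), ... forever. *)
Section path_measure.
Variables (R : realType) (S A : finType) (M : mdp R S A) (sigma : scheduler M).

Definition choice_prob (s : S) (o : option A) : R :=
  if o is Some a then sigma s a else (terminal M s)%:R.

(* A pair (s, Some a) with a disabled in s has probability 0; it is given a
   self-loop in order to have a stochastic matrix. *)
Definition succ_prob (s : S) (o : option A) (t : S) : R :=
  match o with
  | Some a => if enabled M s a then trans M s a t else (t == s)%:R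
  | None => (t == s)%:R
  end.

Definition step_init (x : S * option A) : R :=
  (x.1 == init M)%:R * choice_prob x.1 x.2.

Definition step_trans (x y : S * option A) : R :=
  succ_prob x.1 x.2 y.1 * choice_prob y.1 y.2.

Lemma choice_prob_distr s : is_distr (choice_prob s).
Proof.
split=> [[a|]|]; rewrite /choice_prob ?sched_ge0//.
rewrite (bigID isSome)/= addrC (big_pred1 None)/=; last by case.
rewrite (reindex_omap Some id)/=; last by case.
rewrite (eq_bigl xpredT); last by move=> a; rewrite eqxx.
case: (boolP (terminal M s)) => [/forallP ts|nts]; last first.
  by rewrite add0r sched_sum.
by rewrite big1 ?addr0// => a _; rewrite sched_enabled.
Qed.

Lemma dirac_distr s : is_distr (fun t : S => (t == s)%:R : R).
Proof.
split=> [t|//]; first by [].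
by rewrite (bigD1 s)//= eqxx big1 ?addr0// => t /negbTE ->.
Qed.

Lemma succ_prob_distr s o : is_distr (succ_prob s o).
Proof.
case: o => [a|]; rewrite /succ_prob; last exact: dirac_distr.
case: (boolP (enabled M s a)) => [/eqP e|_]; last exact: dirac_distr.
by split=> // t; case/andP: (trans01 M s a t).
Qed.

Lemma distr_pair (p : S -> R) : is_distr p ->
  is_distr (fun y : S * option A => p y.1 * choice_prob y.1 y.2).
Proof.
move=> [p0 p1]; split=> [y|]; first by rewrite mulr_ge0// (choice_prob_distr _).1.
rewrite -(pair_big xpredT xpredT (fun s o => p s * choice_prob s o))/= -p1.
by apply: eq_bigr => s _; rewrite -mulr_sumr (choice_prob_distr s).2 mulr1.
Qed.

Lemma step_init_distr : is_distr step_init.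
Proof. exact: distr_pair (dirac_distr _). Qed.

Lemma step_trans_distr x : is_distr (step_trans x).
Proof. exact: distr_pair (succ_prob_distr _ _). Qed.

Definition path_chain : markov_chain R (S * option A)%type :=
  MarkovChain step_init_distr step_trans_distr.

Definition path_space := @traj_space (S * option A)%type (init M, None).

Definition path_prob : probability path_space R :=
  @chain_measure R (S * option A)%type (init M, None) path_chain.

Definition occurrences (a : A) (w : path_space) : \bar R :=
  (\sum_(0 <= n <oo) (((w : nat -> S * option A) n).2 == Some a)%:R%:E)%E.

Definition expected_frequency (a : A) : \bar R :=
  (\int[path_prob]_w occurrences a w)%E.

End path_measure.

(* Main.v *)
(* A scheduler of the quotient has no absorbing class of non-terminal states:
   lifted to M, such a class would contain an end component that is not
   included in a maximal one.  Hence the expected numbers V q of visits are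
   finite and are the unique solution of the flow equation of the quotient.
   Together with sigma they prescribe, in M, the flow through all the actions
   outside the maximal end components.  If a maximal end component is left
   (tau is not chosen and V is nonzero), its inflow and outflow have the same
   mass, and strong connectedness gives a strictly positive flow on its own
   actions that balances them; theta plays every action proportionally to the
   total flow.  If it is not left, theta stays in it by playing its actions
   uniformly.  The prescribed flow then solves the flow equation of theta,
   stopped in the end components that are never left; the stopped chain is
   transient by the same end component argument, so that this solution is the
   vector of expected frequencies. *)

From HB Require Import structures.
Require Import Defs.
From mathcomp Require Import all_boot all_order all_algebra.
From mathcomp Require Import all_classical all_reals all_analysis.
From mathcomp Require Import measurable_realfun lra.

Set Implicit Arguments.
Unset Strict Implicit.
Unset Printing Implicit Defensive.

Import Order.TTheory GRing.Theory Num.Theory.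
Import numFieldNormedType.Exports.

Local Open Scope ring_scope.

(** * Transient substochastic matrices *)

Lemma cvg_bigsum (R : realType) (I : Type) (r : seq I) (u : I -> nat -> R)
    (l : I -> R) : (forall i, (u i n @[n --> \oo] --> l i)%classic) ->
  ((\sum_(i <- r) u i n) @[n --> \oo] --> \sum_(i <- r) l i)%classic.
Proof.
move=> ul; elim: r => [|i r IH].
  by under eq_fun do rewrite big_nil; rewrite big_nil; exact: cvg_cst.
by under eq_fun do rewrite big_cons; rewrite big_cons; exact: cvgD.
Qed.

Section transient_matrices.
Local Open Scope classical_set_scope.
Local Open Scope ring_scope.
Variables (R : realType) (F : finType).
Implicit Types (Q : F -> F -> R) (d v : F -> R).

(** Vectors are rows: this is the product d Q, so that [iter n (push Q) d] is the mass distribution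
    at time n of the chain started from d. *)
Definition push Q d t : R := \sum_s d s * Q s t.

Lemma pushE Q d t : push Q d t = \sum_s d s * Q s t.
Proof. by []. Qed.

Definition substochastic Q :=
  (forall s t, 0 <= Q s t) /\ (forall s, \sum_t Q s t <= 1).

Definition absorbing_class Q (B : pred F) :=
  forall s, B s -> \sum_t Q s t = 1 /\ forall t, 0 < Q s t -> B t.

(** A combinatorial form of transience on a finite set: mass leaks out from everywhere. In this form
    it can be refuted or proved by arguments on end components. *)
Definition transient Q := forall B, absorbing_class Q B -> forall s, ~ B s.

Lemma push_ge0 Q d : substochastic Q -> (forall s, 0 <= d s) ->
  forall t, 0 <= push Q d t.
Proof. by move=> [Q0 _] d0 t; apply: sumr_ge0 => s _; rewrite mulr_ge0. Qed.

Lemma iter_push_ge0 Q d n : substochastic Q -> (forall s, 0 <= d s) ->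
  forall t, 0 <= iter n (push Q) d t.
Proof. by move=> hQ d0; elim: n => //= n IH; exact: push_ge0. Qed.

Lemma sum_push Q d : \sum_t push Q d t = \sum_s d s * \sum_t Q s t.
Proof. by rewrite exchange_big /=; apply: eq_bigr => s _; rewrite mulr_sumr. Qed.

Lemma sum_norm_push Q d : substochastic Q ->
  \sum_t `|push Q d t| <= \sum_s `|d s|.
Proof.
move=> [Q0 Q1]; apply: (@le_trans _ _ (\sum_t push Q (fun s => `|d s|) t)).
  apply: ler_sum => t _; apply: le_trans (ler_norm_sum _ _ _) _.
  by apply: ler_sum => s _; rewrite normrM (ger0_norm (Q0 _ _)).
by rewrite sum_push; apply: ler_sum => s _; exact: ler_piMr.
Qed.

(* |v| <= |v| Q, and Q does not increase the total mass: hence |v| = |v| Q and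
   the support of v is an absorbing class. *)
Lemma transient_inj Q v : substochastic Q -> transient Q ->
  (forall t, v t = push Q v t) -> forall t, v t = 0.
Proof.
move=> [Q0 Q1] trQ vQ t; apply/eqP; apply: contrapT => /negP vt.
pose a s := `|v s|; have a0 s : 0 <= a s by exact: normr_ge0.
have le1 s : a s <= push Q a s.
  rewrite /a vQ; apply: le_trans (ler_norm_sum _ _ _) _.
  by apply: ler_sum => u _; rewrite normrM (ger0_norm (Q0 _ _)).
have sle : \sum_s a s * \sum_u Q s u <= \sum_s a s.
  by apply: ler_sum => s _; apply: ler_piMr.
have eqs : \sum_s (push Q a s - a s) = 0.
  apply/eqP; rewrite eq_le; apply/andP; split.
    by rewrite sumrB sum_push subr_le0.
  by apply: sumr_ge0 => s _; rewrite subr_ge0.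
have eqs' : \sum_s (a s - a s * \sum_u Q s u) = 0.
  by rewrite sumrB -sum_push; apply/eqP; rewrite subr_eq0 eq_sym -subr_eq0 -sumrB eqs.
have aE s : push Q a s = a s.
  apply/eqP; rewrite -subr_eq0.
  move/eqP: eqs; rewrite psumr_eq0 => [/allP/(_ s)|u _]; last by rewrite subr_ge0.
  by rewrite mem_index_enum => /(_ isT).
have row1 s : v s != 0 -> \sum_u Q s u = 1.
  move=> vs; move/eqP: eqs'; rewrite psumr_eq0 => [/allP/(_ s)|u _]; last first.
    by rewrite subr_ge0 ler_piMr.
  rewrite mem_index_enum => /(_ isT) /=.
  rewrite -{1}[a s]mulr1 -mulrBr mulf_eq0 normr_eq0 (negbTE vs) subr_eq0 /=.
  by move/eqP.
apply: (trQ (fun s => v s != 0) _ t vt) => s vs; split; first exact: row1.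
move=> u Qsu; rewrite -normr_gt0 -/(a u) -aE.
apply: (@lt_le_trans _ _ (a s * Q s u)); first by rewrite mulr_gt0 // normr_gt0.
rewrite /push (bigD1 s) //= lerDl; apply: sumr_ge0 => w _.
by rewrite mulr_ge0 // normr_ge0.
Qed.

(** By [transient_inj] the endomorphism v - v Q of a finite-dimensional space is injective, hence
    surjective. Functions are packed as [{ffun F -> R^o}] to have that vector space. *)
Lemma transient_solve Q d : substochastic Q -> transient Q ->
  exists v, forall t, v t = d t + push Q v t.
Proof.
move=> hQ trQ.
pose f (v : {ffun F -> R^o}) : {ffun F -> R^o} := [ffun t => v t - push Q v t].
have flin : linear f.
  move=> c u v; apply/ffunP => t; rewrite !ffunE /push.
  have -> : \sum_s (c *: u + v) s * Q s t =
      c * (\sum_s u s * Q s t) + \sum_s v s * Q s t.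
    rewrite mulr_sumr -big_split /=; apply: eq_bigr => s _.
    by rewrite !ffunE mulrDl mulrA.
  by rewrite /GRing.scale /= mulrBr opprD addrACA.
pose fL := GRing.isLinear.Build _ _ _ _ f flin.
pose g : {linear {ffun F -> R^o} -> {ffun F -> R^o}} := HB.pack f fL.
have kg : lker (linfun g) == 0%VS.
  apply/lker0P => u v; rewrite !lfunE /= => /ffunP uv.
  apply/ffunP => t; apply/eqP; rewrite -subr_eq0; apply/eqP.
  apply: (@transient_inj Q (fun t => u t - v t)) => // s.
  move: (uv s); rewrite !ffunE /push => e.
  under eq_bigr do rewrite mulrBl.
  by rewrite sumrB; lra.
have ev := lker0_lfunVK kg [ffun t => d t].
exists ((linfun g)^-1%VF [ffun t => d t]) => t.
by move/ffunP/(_ t): ev; rewrite lfunE /= !ffunE => <-; rewrite subrK.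
Qed.

(** The partial sums increase and differ from v by v Q^n, whose l1 norm is at most that of v; so
    they converge. Their limit solves the same equation as v, and [transient_inj] identifies the
    two. *)
Lemma transient_series Q d v : substochastic Q -> transient Q ->
  (forall t, 0 <= d t) -> (forall t, v t = d t + push Q v t) ->
  forall t, (fun n => \sum_(0 <= k < n) iter k (push Q) d t) @ \oo --> v t.
Proof.
move=> hQ trQ d0 vE.
pose S n t := \sum_(0 <= k < n) iter k (push Q) d t.
have SS n t : S n.+1 t = d t + push Q (S n) t.
  rewrite /S big_nat_recl //= /push; congr (_ + _).
  rewrite exchange_big /=.
  by apply: eq_bigr => k _; rewrite mulr_suml.
have Snd t : nondecreasing_seq (S ^~ t).
  apply/nondecreasing_seqP => n; rewrite /S big_nat_recr //= lerDl.
  exact: iter_push_ge0.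
have vS n t : v t - S n t = iter n (push Q) v t.
  elim: n t => [|n IH] t; first by rewrite /S big_geq // subr0.
  rewrite SS {1}vE iterS opprD addrACA subrr add0r /push -sumrB.
  by apply: eq_bigr => s _; rewrite -mulrBl IH.
have itb n : \sum_s `|iter n (push Q) v s| <= \sum_s `|v s|.
  by elim: n => //= n IH; apply: le_trans (sum_norm_push _ hQ) IH.
have cS t : cvgn (S ^~ t).
  apply: nondecreasing_is_cvgn => //; exists (v t + \sum_s `|v s|) => _ [n _ <-].
  have -> : S n t = v t - iter n (push Q) v t by rewrite -vS; lra.
  rewrite lerD2l; apply: le_trans (itb n).
  apply: le_trans (ler_norm _) _; rewrite normrN (bigD1 t) //= lerDl.
  by apply: sumr_ge0.
pose w t := limn (S ^~ t).
have wE t : w t = d t + push Q w t.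
  have : (fun n => S n.+1 t) @ \oo --> w t.
    by have := cS t; rewrite -cvg_shiftS.
  move/cvg_lim => <- //; apply/cvg_lim => //.
  under eq_fun do rewrite SS.
  apply: cvgD; first exact: cvg_cst.
  by apply: cvg_bigsum => s; apply: cvgM; [exact: cS|exact: cvg_cst].
move=> t; suff -> : v t = w t by exact: cS.
apply/eqP; rewrite -subr_eq0; apply/eqP.
apply: (@transient_inj Q (fun t => v t - w t)) => // s.
rewrite /push; under eq_bigr do rewrite mulrBl.
by rewrite sumrB {1}vE {1}wE /push; lra.
Qed.

Lemma transient_solution_ge0 Q d v : substochastic Q -> transient Q ->
  (forall t, 0 <= d t) -> (forall t, v t = d t + push Q v t) ->
  forall t, 0 <= v t.
Proof.
move=> hQ trQ d0 vE t; have c := transient_series hQ trQ d0 vE (t := t).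
rewrite -(cvg_lim _ c) //; apply: limr_ge; first by apply/cvg_ex; exists (v t).
by near=> n; apply: sumr_ge0 => k _; exact: iter_push_ge0.
Unshelve. all: by end_near. Qed.

End transient_matrices.

Arguments push : simpl never.

(* Killing the chain at a root r makes it transient.  A solution z of
   z = d + z Q for the killed chain Q satisfies z r = \sum_t d t, so that it
   solves the original equation when this sum vanishes; d := P r yields a
   positive stationary vector, a large multiple of which can be added. *)
Lemma poisson_positive (R : realType) (F : finType) (U : {set F})
    (P : F -> F -> R) (d : F -> R) :
  U != finset.set0 -> (forall s t, 0 <= P s t) ->
  (forall s, s \in U -> \sum_t P s t = 1) ->
  (forall s t, s \in U -> 0 < P s t -> t \in U) ->
  {in U &, forall s t, connect [rel s t | 0 < P s t] s t} ->
  (forall t, t \notin U -> d t = 0) -> \sum_t d t = 0 ->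
  exists z, [/\ forall s, s \notin U -> z s = 0, forall s, s \in U -> 0 < z s
    & forall t, z t = d t + push P z t].
Proof.
move=> /finset.set0Pn[r rU] P0 P1 PU conn dU sumd.
pose Q s t := if (s \in U) && (s != r) then P s t else 0.
have PU0 s t : s \in U -> t \notin U -> P s t = 0.
  move=> sU; apply: contraNeq => Pst; apply: PU sU _.
  by rewrite lt_def Pst P0.
have rowQ s : \sum_t Q s t = ((s \in U) && (s != r))%:R.
  have [sUr|/negbTE sUr] := boolP ((s \in U) && (s != r)).
    by rewrite /Q sUr P1 //; case/andP: sUr.
  by rewrite /Q sUr big1.
have sQ : substochastic Q.
  split=> [s t|s]; first by rewrite /Q; case: ifP.
  by rewrite rowQ lern1 leq_b1.
(* An absorbing class would lie in [U] without r, since only those rows of [Q] have sum 1; following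
   a path to r inside the class would then put r in it. *)
have tQ : transient Q.
  move=> B BQ s Bs.
  have inU t : B t -> (t \in U) && (t != r).
    move=> /BQ[+ _]; rewrite rowQ; case: (_ && _) => // /eqP.
    by rewrite eq_sym oner_eq0.
  have /andP[sU _] := inU _ Bs; have /connectP[p pp rE] := conn _ _ sU rU.
  have : B r.
    elim: p s Bs {sU} pp rE => [s Bs _ -> //|t p IH s Bs /= /andP[st tp] rE].
    apply: IH tp rE; have [_] := BQ _ Bs; apply.
    by rewrite /Q inU.
  by move/inU; rewrite eqxx andbF.
(* Summing the equation over all states cancels every term but z r: the rows of [Q] at the other
   states of [U] have sum 1, and z vanishes outside [U]. This is used with f = d and with f = P
   r. *)
have sol (f : F -> R) (z : F -> R) : (forall t, t \notin U -> f t = 0) ->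
    (forall t, z t = f t + push Q z t) ->
    [/\ forall t, t \notin U -> z t = 0, z r = \sum_t f t
      & forall t, push P z t = push Q z t + z r * P r t].
  move=> fU zE.
  have zU t : t \notin U -> z t = 0.
    move=> tU; rewrite zE fU // add0r pushE big1 // => s _.
    rewrite /Q; case: ifP => [/andP[sU _]|_]; last by rewrite mulr0.
    by rewrite PU0 ?mulr0.
  split=> // [|t].
    have : \sum_t z t = \sum_t f t + \sum_t push Q z t.
      by rewrite -big_split; apply: eq_bigr.
    rewrite sum_push => e; have {e} : \sum_t z t - \sum_s z s * \sum_t Q s t =
      \sum_t f t by rewrite e addrK.
    rewrite -sumrB (bigD1 r) //= rowQ eqxx andbF mulr0 subr0 big1 ?addr0 //.
    move=> s sr; rewrite rowQ sr andbT.
    by case: (boolP (s \in U)) => [_|/zU ->]; rewrite ?mulr1 ?subrr // mul0r subr0.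
  have Qr : Q r t = 0 by rewrite /Q eqxx andbF.
  rewrite !pushE (bigD1 r) //= [in RHS](bigD1 r) //= Qr mulr0 add0r.
  rewrite addrC; congr (_ + _); apply: eq_bigr => s sr.
  by rewrite /Q sr andbT; case: ifP => // /negbT/zU ->; rewrite !mul0r.
have [z1 z1E] := transient_solve d sQ tQ.
have [z2 z2E] := transient_solve (P r) sQ tQ.
have [z1U z1r z1P] := sol _ _ dU z1E.
have [z2U z2r z2P] := sol _ _ (fun t => PU0 r t rU) z2E.
rewrite P1 // in z2r; rewrite sumd in z1r.
have z2_ge0 := transient_solution_ge0 sQ tQ (P0 r) z2E.
have z2S t : z2 t = push P z2 t by rewrite z2P z2r mul1r {1}z2E addrC.
(* Positivity spreads from r, where z2 is 1, along the edges of a path to t, because z2 is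
   stationary. *)
have z2_gt0 t : t \in U -> 0 < z2 t.
  move=> tU; have /connectP[p pp ->] := conn _ _ rU tU.
  have : 0 < z2 r by rewrite z2r.
  elim: p (r) {tU} pp => // s p IH u /= /andP[us sp] zu; apply: IH sp _.
  rewrite z2S pushE (bigD1 u) //= ltr_wpDr ?mulr_gt0 //.
  by apply: sumr_ge0 => w _; rewrite mulr_ge0.
(* Each single summand is already large enough for its own t, so the sum works for all t at once. *)
pose c := \sum_(t in U) (`|z1 t| + 1) / z2 t.
have c_large t : t \in U -> 0 < z1 t + c * z2 t.
  move=> tU; have z2t := z2_gt0 _ tU.
  have : `|z1 t| + 1 <= c * z2 t.
    rewrite -ler_pdivrMr // /c (bigD1 t) //= lerDl; apply: sumr_ge0 => s.
    by move=> /andP[sU _]; rewrite divr_ge0 ?addr_ge0.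
  by have := ler_norm (- z1 t); rewrite normrN; lra.
exists (fun t => z1 t + c * z2 t); split => // [s sU|t].
  by rewrite z1U // z2U // mulr0 addr0.
have -> : push P (fun t => z1 t + c * z2 t) t = push P z1 t + c * push P z2 t.
  rewrite !pushE mulr_sumr -big_split; apply: eq_bigr => s _ /=.
  by rewrite mulrDl mulrA.
by rewrite -z2S z1P z1r mul0r addr0 {1}z1E addrA.
Qed.

(** * Expected frequencies as series *)

Lemma iter_push_sum (R : realType) (F G : finType) (Q : F -> F -> R)
    (d : G -> R) (P : G -> F -> R) n t :
  iter n (push Q) (fun x => \sum_y d y * P y x) t =
  \sum_y d y * iter n (push Q) (P y) t.
Proof.
elim: n t => // n IH t; rewrite iterS pushE.
under [LHS]eq_bigr do rewrite IH mulr_suml.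
rewrite exchange_big /=; apply: eq_bigr => y _.
rewrite pushE mulr_sumr.
by apply: eq_bigr => s _; rewrite mulrA.
Qed.

Section marginals.
Local Open Scope classical_set_scope.
Local Open Scope ring_scope.
Variables (R : realType) (F : finType) (x0 : F) (C : markov_chain R F).

(** [prefix_prob] conditions on the first state, whereas iterating [push] appends a last one;
    linearity in the starting vector ([iter_push_sum]) and [iterSr] reconcile the two recursions. *)
Lemma prefix_prob_marginal n (d : F -> R) (P : pred F) :
  prefix_prob C n.+1 d [set w : traj x0 | P (w n)] =
  \sum_(x | P x) iter n (push (mc_step C)) d x.
Proof.
rewrite prefix_prob_rec.
elim: n d => [|n IH] d.
  rewrite [RHS]big_mkcond /=; apply: eq_bigr => y _; rewrite indicE.
  by case: ifP => Py; [rewrite mem_set ?mulr1|rewrite memNset ?mulr0 //= Py].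
under eq_bigr do rewrite prefix_prob_rec IH mulr_sumr.
rewrite exchange_big /=; apply: eq_bigr => x _.
by rewrite -iter_push_sum -iterSr.
Qed.

Lemma depends_on_marginal n (P : pred F) :
  depends_on n.+1 [set w : traj x0 | P (w n)].
Proof. by move=> w w' /= e; rewrite e. Qed.

Lemma chain_measure_marginal n (P : pred F) :
  chain_measure (x0 := x0) C [set w : traj x0 | P (w n)] =
  (\sum_(x | P x) iter n (push (mc_step C)) (mc_init C) x)%:E.
Proof.
have dP := @depends_on_marginal n P.
rewrite chain_measure_cylinder; last by exists n.+1.
by rewrite (cylinder_probE C dP) prefix_prob_marginal.
Qed.

Lemma measurable_marginal n (P : pred F) :
  measurable ([set w | P (w n)] : set (@traj_space F x0)).
Proof.
by apply: sub_sigma_algebra; exists n.+1; exact: depends_on_marginal.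
Qed.

End marginals.

Lemma sum_option (R : nmodType) (T : finType) (F : option T -> R) :
  \sum_o F o = F None + \sum_a F (Some a).
Proof.
rewrite (bigID isSome) /= [X in _ + X](big_pred1 None); last by case.
rewrite (reindex_omap Some id) /=; last by case.
by rewrite addrC; congr (_ + _); apply: eq_bigl => a; rewrite eqxx.
Qed.

Section frequencies.
Local Open Scope classical_set_scope.
Local Open Scope ring_scope.
Variables (R : realType) (S A : finType) (M : mdp R S A) (sigma : scheduler M).

(** The row of a terminal state is zero, whereas [path_chain] loops there forever: mass is lost when
    a path ends, which makes transience possible. *)
Definition state_step (s t : S) : R := \sum_a sigma s a * trans M s a t.

Definition start (s : S) : R := (s == init M)%:R.

Lemma trans_ge0 s a t : 0 <= trans M s a t.
Proof. by case/andP: (trans01 M s a t). Qed.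

Lemma sched_terminal s a : terminal M s -> sigma s a = 0.
Proof. by move=> /forallP ts; rewrite sched_enabled. Qed.

Lemma sched_neq0_enabled s a : sigma s a != 0 -> enabled M s a.
Proof. by apply: contraNT => /(sched_enabled sigma) ->. Qed.

Lemma state_step_gt0 s a t : 0 < sigma s a -> 0 < trans M s a t ->
  0 < state_step s t.
Proof.
move=> sa st; rewrite /state_step (bigD1 a) // ltr_wpDr ?mulr_gt0 //.
by apply: sumr_ge0 => b _; rewrite mulr_ge0 ?sched_ge0 ?trans_ge0.
Qed.

Lemma sum_state_step s : \sum_t state_step s t = \sum_a sigma s a.
Proof.
rewrite exchange_big /=; apply: eq_bigr => a _; rewrite -mulr_sumr.
have [/eqP ->|/(sched_enabled sigma) ->] := boolP (enabled M s a).
  by rewrite mulr1.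
by rewrite mul0r.
Qed.

Lemma state_step_substochastic : substochastic state_step.
Proof.
split=> [s t|s].
  by apply: sumr_ge0 => a _; rewrite mulr_ge0 ?sched_ge0 ?trans_ge0.
rewrite sum_state_step; have [ts|/(sched_sum sigma) -> //] := boolP (terminal M s).
by rewrite big1 // => a _; rewrite sched_terminal.
Qed.

Lemma start_ge0 s : 0 <= start s. Proof. exact: ler0n. Qed.

(** The choice of the action depends on the current state only, so the law of the pair at time n is
    the law of the state times the choice. *)
Lemma iter_step_trans n s a :
  iter n (push (step_trans sigma)) (step_init sigma) (s, Some a) =
  iter n (push state_step) start s * sigma s a.
Proof.
(* A padding pair [(t, None)] carries mass only if t is terminal, and there [sigma] vanishes:
   padding never contributes to an action. *)
have none k t b :
    iter k (push (step_trans sigma)) (step_init sigma) (t, None) * sigma t b = 0.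
  have [tt|tt] := boolP (terminal M t); first by rewrite sched_terminal ?mulr0.
  case: k => [|k]; rewrite /= /push /step_init /step_trans /= (negbTE tt).
    by rewrite mulr0 mul0r.
  by rewrite big1 ?mul0r // => x _; rewrite !mulr0.
elim: n s a => [//|n IH] t b; rewrite !iterS pushE.
rewrite (_ : \sum_x _ = \sum_s \sum_o
  iter n (push (step_trans sigma)) (step_init sigma) (s, o) *
  step_trans sigma (s, o) (t, Some b)); last first.
  by rewrite pair_bigA /=; apply: eq_bigr => -[].
rewrite pushE mulr_suml.
apply: eq_bigr => s _.
rewrite sum_option.
have -> : iter n (push (step_trans sigma)) (step_init sigma) (s, None) *
    step_trans sigma (s, None) (t, Some b) = 0.
  rewrite /step_trans /=; case: eqP => [->|_]; last by rewrite mul0r mulr0.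
  by rewrite mul1r none.
rewrite add0r /state_step mulr_sumr mulr_suml; apply: eq_bigr => a _.
rewrite IH /step_trans /=; case: ifP => [_|/negbT/(sched_enabled sigma) ->].
  by rewrite !mulrA.
by rewrite !(mulr0, mul0r).
Qed.

(** Monotone convergence exchanges the integral with the sum over time; each term is then the
    probability of a one-time marginal. *)
Lemma expected_frequencyE a : expected_frequency sigma a =
  (\sum_(0 <= n <oo)
     (\sum_s iter n (push state_step) start s * sigma s a)%:E)%E.
Proof.
have mX n := @measurable_marginal _ (init M, None : option A) n
  (fun x : S * option A => x.2 == Some a).
rewrite /expected_frequency /occurrences integral_nneseries //=; last first.
  move=> n; apply/measurable_EFinP.
  rewrite (_ : (fun _ => _) = \1_[set w : path_space M | (w n).2 == Some a]).
    exact: measurable_indic.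
  apply/funext => w; rewrite indicE.
  by case: (boolP (_ == _)) => h; [rewrite mem_set|rewrite memNset //; apply/negP].
apply: eq_eseriesr => n _.
rewrite (eq_integral (fun w =>
    (\1_[set w : path_space M | (w n).2 == Some a] w)%:E)); last first.
  move=> w _; rewrite indicE.
  by case: (boolP (_ == _)) => h; [rewrite mem_set|rewrite memNset //; apply/negP].
rewrite integral_indic // setIT.
rewrite [LHS](@chain_measure_marginal _ _ _ _ n
  (fun x : S * option A => x.2 == Some a)); congr _%:E => /=.
rewrite (reindex_omap (fun s => (s, Some a)) (fun x => Some x.1)) /=; last first.
  by move=> [s o] /= /eqP ->.
rewrite (eq_bigl xpredT); last by move=> s; rewrite !eqxx.
by apply: eq_bigr => s _; exact: iter_step_trans.
Qed.

(** Convergence is asked only at states where [a] can be played: in an end component that is never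
    left, the expected number of visits may be infinite. *)
Lemma expected_frequency_limit a (v : S -> R) :
  (forall s, sigma s a != 0 ->
    (fun n => \sum_(0 <= k < n) iter k (push state_step) start s)
      @ \oo --> v s) ->
  expected_frequency sigma a = (\sum_s v s * sigma s a)%:E.
Proof.
move=> vP; rewrite expected_frequencyE; apply/cvg_lim => //.
have -> : (fun n => \sum_(0 <= k < n)
      (\sum_s iter k (push state_step) start s * sigma s a)%:E)%E =
    EFin \o (fun n => \sum_s
      (\sum_(0 <= k < n) iter k (push state_step) start s) * sigma s a).
  apply/funext => n /=; rewrite sumEFin exchange_big /=; congr _%:E.
  by apply: eq_bigr => s _; rewrite mulr_suml.
apply: cvg_EFin; first by near=> n.
apply: cvg_bigsum => s.
have [->|/vP vs] := eqVneq (sigma s a) 0.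
  by rewrite mulr0; under eq_fun do rewrite mulr0; exact: cvg_cst.
by apply: cvgM => //; exact: cvg_cst.
Unshelve. all: by end_near. Qed.

End frequencies.

(** * Maximal end components *)

Section end_components.
Variables (R : realType) (S A : finType) (M : mdp R S A).
Implicit Types (s t u : S) (a : A) (E : mec M) (D : {set S} * {set S * A}).

Lemma submdpP D : reflect
  (D.1 != finset.set0 /\ forall s a, (s, a) \in D.2 ->
     [/\ s \in D.1, enabled M s a & forall t, 0 < trans M s a t -> t \in D.1])
  (submdp M D).
Proof.
apply: (iffP andP) => -[D0 H]; split => //.
  move=> s a sa; move/forallP/(_ s)/forallP/(_ a)/implyP/(_ sa): H.
  by case/and3P => ? ? /forallP h; split => // t; exact/implyP.
apply/forallP => s; apply/forallP => a; apply/implyP => /H[-> -> h] /=.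
by apply/forallP => t; apply/implyP; exact: h.
Qed.

Lemma end_componentP D : reflect
  [/\ submdp M D, {in D.1 &, forall s t, connect (submdp_edge M D) s t}
    & D.2 != finset.set0] (end_component M D).
Proof.
apply: (iffP and3P) => -[? H ?]; split => //.
  by move=> s t sD tD; move/forall_inP/(_ s sD)/forall_inP/(_ t tD): H.
by apply/forall_inP => s sD; apply/forall_inP => t tD; exact: H.
Qed.

Lemma submdp_edge_sub D D' : D.2 \subset D'.2 ->
  subrel (connect (submdp_edge M D)) (connect (submdp_edge M D')).
Proof.
move=> DD'; apply: connect_sub => s t /existsP[a /andP[sa st]].
by apply: connect1; apply/existsP; exists a; rewrite (fintype.subsetP DD').
Qed.

(** Among the end components containing [D], one with the largest total number of states and pairs
    is maximal for inclusion. *)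
Lemma end_component_sub_mec D : end_component M D ->
  exists E, D.1 \subset mec_states E /\ D.2 \subset mec_pairs E.
Proof.
move=> ecD.
pose P (C : {set S} * {set S * A}) :=
  [&& end_component M C, D.1 \subset C.1 & D.2 \subset C.2].
have PD : P D by rewrite /P ecD !subxx.
case: (arg_maxnP (fun C : {set S} * {set S * A} => #|C.1| + #|C.2|)%N PD) => C /and3P[ecC D1 D2] maxC.
have mC : max_end_component M C.
  rewrite /max_end_component ecC; apply/forallP => -[B1 B2]; apply/implyP.
  move=> /and3P[ecB /= C1 C2].
  have leB : (#|B1| + #|B2| <= #|C.1| + #|C.2|)%N.
    apply: (maxC (B1, B2)).
    by rewrite /P ecB (fintype.subset_trans D1) // (fintype.subset_trans D2).
  have c1 := subset_leq_card C1; have c2 := subset_leq_card C2.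
  have /eqP <- : C.1 == B1.
    by rewrite eqEcard C1 -(leq_add2r #|B2|) (leq_trans leB) ?leq_add2l.
  have /eqP <- : C.2 == B2.
    by rewrite eqEcard C2 -(leq_add2l #|B1|) (leq_trans leB) ?leq_add2r.
  by apply/eqP; case: (C).
by exists (exist _ C mC).
Qed.

Lemma mec_end_component E : end_component M (sval E).
Proof. by case: E => C /= /andP[]. Qed.

Lemma mec_pairsP E s a : (s, a) \in mec_pairs E ->
  [/\ s \in mec_states E, enabled M s a &
      forall t, 0 < trans M s a t -> t \in mec_states E].
Proof. by have /end_componentP[/submdpP[_ h] _ _] := mec_end_component E => /h. Qed.

Lemma mec_connect E s t : s \in mec_states E -> t \in mec_states E ->
  connect (submdp_edge M (sval E)) s t.
Proof. by have /end_componentP[_ h _] := mec_end_component E => /h; apply. Qed.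

Lemma mec_neq0 E : exists s, s \in mec_states E.
Proof.
by have /end_componentP[/submdpP[/finset.set0Pn]] := mec_end_component E.
Qed.

(** Some pair exists, with source u say. Either s is u, or the first edge of a path from s to u
    comes from a pair at s. *)
Lemma mec_has_pair E s : s \in mec_states E -> exists a, (s, a) \in mec_pairs E.
Proof.
move=> sE; have /end_componentP[_ _ /finset.set0Pn[[u b] ub]] := mec_end_component E.
have [uE _ _] := mec_pairsP ub.
have /connectP[[|t p]] := mec_connect sE uE => /=.
  by move=> _ us; exists b; rewrite -us.
by case/andP => /existsP[a /andP[sa _]] _ _; exists a.
Qed.

(** The union of both is an end component, as any two of its states are connected through s; by
    maximality each of the two equals the union. *)
Lemma mec_uniq E E' s : s \in mec_states E -> s \in mec_states E' -> E = E'.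
Proof.
move=> sE sE'.
pose U := (mec_states E :|: mec_states E', mec_pairs E :|: mec_pairs E')%SET.
have sub1 : mec_pairs E \subset U.2 by exact: finset.subsetUl.
have sub2 : mec_pairs E' \subset U.2 by exact: finset.subsetUr.
have ecU : end_component M U.
  apply/end_componentP; split.
  - apply/submdpP; split; first by apply/finset.set0Pn; exists s; rewrite inE sE.
    move=> u a; rewrite inE => /orP[]/mec_pairsP[uE ua h]; split => //;
      by [rewrite inE uE ?orbT|move=> t /h tE; rewrite inE tE ?orbT].
  - have toS u : u \in U.1 -> connect (submdp_edge M U) u s /\
        connect (submdp_edge M U) s u.
      rewrite inE => /orP[uE|uE].
        by split; apply: (submdp_edge_sub sub1); exact: mec_connect.
      by split; apply: (submdp_edge_sub sub2); exact: mec_connect.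
    by move=> u t /toS[us _] /toS[_ st]; exact: connect_trans us st.
  - have [a sa] := mec_has_pair sE.
    by apply/finset.set0Pn; exists (s, a); exact: (fintype.subsetP sub1).
have eqU (C : mec M) : mec_states C \subset U.1 -> mec_pairs C \subset U.2 ->
    sval C = U.
  case: C => C mC C1 C2; have /andP[_ /forallP/(_ U)/implyP h] := mC.
  by apply/esym/eqP/h; rewrite ecU C1 C2.
apply: val_inj; rewrite /= (eqU E) ?finset.subsetUl //.
by rewrite (eqU E') // finset.subsetUr.
Qed.

Definition mec_pair (s : S) (a : A) : bool :=
  [exists E : mec M, (s, a) \in mec_pairs E].

Lemma mec_pairE E s a : s \in mec_states E ->
  mec_pair s a = ((s, a) \in mec_pairs E).
Proof.
move=> sE; apply/existsP/idP => [[E' sa]|sa]; last by exists E.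
by have [sE' _ _] := mec_pairsP sa; rewrite (mec_uniq sE sE').
Qed.

Lemma mec_pair_outside s a : ~~ in_mec M s -> mec_pair s a = false.
Proof.
move=> sM; apply: contraNF sM => /existsP[E /mec_pairsP[sE _ _]].
by apply/existsP; exists E.
Qed.

Lemma iota_mec E s : s \in mec_states E -> Defs.iota M s = q_mec E.
Proof.
move=> sE; rewrite /Defs.iota insubF; last first.
  by apply/negbTE; rewrite negbK; apply/existsP; exists E.
case: pickP => [E' /(mec_uniq sE) -> //|/(_ E)]; by rewrite sE.
Qed.

Lemma iota_outside (x : {s : S | ~~ in_mec M s}) : Defs.iota M (val x) = q_outside x.
Proof. by rewrite /Defs.iota valK. Qed.

Variant iota_spec s : quot_state M -> Type :=
| IotaOutside x of s = val x : iota_spec s (q_outside x)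
| IotaMec E of s \in mec_states E : iota_spec s (q_mec E).

Lemma iotaP s : iota_spec s (Defs.iota M s).
Proof.
have [sM|sM] := boolP (in_mec M s).
  have [E sE] := cid (elimT existsP sM); rewrite (iota_mec sE); exact: IotaMec.
by rewrite -[s]/(val (Sub s sM : {s | ~~ in_mec M s})) iota_outside;
  exact: IotaOutside.
Qed.

Lemma iota_eq_mec s E : (Defs.iota M s == q_mec E) = (s \in mec_states E).
Proof.
apply/eqP/idP => [|/iota_mec //]; case: iotaP => // E' sE' [<-] //.
Qed.

Lemma iota_eq_outside s x : (Defs.iota M s == q_outside x) = (s == val x).
Proof.
apply/eqP/eqP => [|-> ]; last exact: iota_outside.
by case: iotaP => // y -> [->].
Qed.

(* The states reachable from a state of B with a minimal reachable set form an
   end component; the maximal end component containing it is itself contained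
   in that set, which the outgoing pair contradicts. *)
Lemma no_closed_class (B : pred S) (K : S -> A -> bool) s0 : B s0 ->
  (forall s, B s -> exists a, K s a) ->
  (forall s a, B s -> K s a ->
     enabled M s a /\ forall t, 0 < trans M s a t -> B t) ->
  (forall E s, B s -> s \in mec_states E ->
     (forall u a, (u, a) \in mec_pairs E -> K u a) /\
     exists u a, [/\ u \in mec_states E, (u, a) \notin mec_pairs E & K u a]) ->
  False.
Proof.
move=> Bs0 KB KP KE.
pose e : rel S := [rel s t | [exists a, K s a && (0 < trans M s a t)]].
pose r s := [set t | connect e s t]%SET.
have Be s t : connect e s t -> B s -> B t.
  move=> /connectP[p]; elim: p s => [s _ -> //|u p IH s] /=.
  move=> /andP[/existsP[a /andP[Ka su]]] up tE Bs.
  by apply: IH up tE _; have [_] := KP _ _ Bs Ka; apply.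
case: (arg_minnP (fun s => #|r s|) Bs0) => s Bs smin.
(* The set reachable from t is contained in that of s, and by minimality it is no smaller; so it
   contains s. *)
have back t : connect e s t -> connect e t s.
  move=> st; have /eqP : r t == r s.
    rewrite eqEcard smin ?(Be _ _ st) // andbT.
    by apply/fintype.subsetP => u; rewrite !inE; exact: connect_trans.
  by move/finset.setP/(_ s); rewrite !inE connect0.
pose D := (r s, [set p | (p.1 \in r s) && K p.1 p.2]%SET).
have eD u t : connect e s u -> connect e u t -> connect (submdp_edge M D) u t.
  move=> + /connectP[p]; elim: p u => [u _ _ -> //|v p IH u su] /=.
  move=> /andP[uv vp] tE; have sv := connect_trans su (connect1 uv).
  apply: connect_trans (IH _ sv vp tE); apply: connect1.
  by move: uv => /existsP[a /andP[Ka ua]]; apply/existsP; exists a;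
    rewrite !inE /= su Ka.
have ecD : end_component M D.
  apply/end_componentP; split.
  - apply/submdpP; split; first by apply/finset.set0Pn; exists s; rewrite inE.
    move=> u a; rewrite !inE /= => /andP[su Ka].
    have [ua h] := KP _ _ (Be _ _ su Bs) Ka.
    split => // t ut; rewrite inE; apply: connect_trans su (connect1 _).
    by apply/existsP; exists a; rewrite Ka.
  - move=> u t; rewrite !inE => su st; apply: eD => //.
    exact: connect_trans (back _ su) st.
  - by have [a Ka] := KB _ Bs; apply/finset.set0Pn; exists (s, a);
      rewrite !inE /= Ka connect0.
have [E [D1 D2]] := end_component_sub_mec ecD.
have sE : s \in mec_states E by apply: (fintype.subsetP D1); rewrite inE.
have [EK [u [a [uE ua Ka]]]] := KE _ _ Bs sE.
(* A path inside [E] uses pairs of [E] only, and these all satisfy [K]. *)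
have su : connect e s u.
  have /connectP[p pp ->] := mec_connect sE uE.
  elim: p s {Bs smin back D eD ecD D1 D2 sE} pp => [//|v p IH s] /=.
  move=> /andP[/existsP[b /andP[sb sv]] vp].
  apply: connect_trans (IH _ vp); apply: connect1.
  by apply/existsP; exists b; rewrite EK.
by move/negP: ua; apply; apply: (fintype.subsetP D2); rewrite !inE /= su.
Qed.

End end_components.

(** * Transience of the MEC-quotient *)

Section quotient.
Variables (R : realType) (S A : finType) (M : mdp R S A).
Hypothesis hdisj : disjoint_actions M.
Implicit Types (E : mec M) (q : quot_state M).

Local Notation MQ := (mec_quotient M).

(** Recovers the state of [M] hidden by the [pick] in [quot_trans]; for disjoint action sets it is
    the only candidate. *)
Lemma quot_action q a : enabled MQ q (Some a) -> exists u,
  [/\ Defs.iota M u = q, enabled M u a, ~~ mec_pair M u a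
    & forall q', trans MQ q (Some a) q' = trans_iota u a q'].
Proof.
case: q => [[x|E]|] /=; rewrite /enabled /=.
- rewrite trans_iota_sum => xa; exists (val x).
  rewrite iota_outside; split => //.
  by rewrite mec_pair_outside //; exact: valP x.
- case: pickP => [u /andP[uE /andP[ua uaE]] _|_]; last first.
    by rewrite big1 // eq_sym oner_eq0.
  by exists u; rewrite (iota_mec uE) (mec_pairE _ uE).
- by rewrite big1 // eq_sym oner_eq0.
Qed.

Lemma terminal_bot : terminal MQ (q_bot M).
Proof.
by apply/forallP => b; rewrite /enabled /= big1 // eq_sym oner_eq0.
Qed.

Lemma outside_tau (sigma : scheduler MQ) x : sigma (q_outside x) None = 0.
Proof.
by apply: sched_enabled; rewrite /enabled /= big1 // eq_sym oner_eq0.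
Qed.

(** An absorbing class of the quotient is pulled back along [iota]. Inside a maximal end component
    all its pairs may be used, and the action played at its quotient state provides the outgoing
    pair required by [no_closed_class]. *)
Lemma quotient_transient (sigma : scheduler MQ) : transient (state_step sigma).
Proof.
move=> Bq Babs q0 Bq0.
have botB : ~~ Bq (q_bot M).
  apply/negP => /Babs[+ _]; rewrite sum_state_step big1 => [/eqP|b _].
    by rewrite eq_sym oner_eq0.
  exact: sched_terminal terminal_bot.
(* A row sum 1 forces some action to be played. It cannot be only tau, which is disabled outside the
   components and otherwise leads to [q_bot], a state that is not in the class. *)
have actB q : Bq q -> exists a, 0 < sigma q (Some a).
  move=> Bqq; have [+ qB] := Babs _ Bqq; rewrite sum_state_step => q1.
  have [b qb] : exists b, 0 < sigma q b.
    apply: contrapT => /forallNP nb; move/eqP: q1; rewrite big1 => [|b _].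
      by rewrite eq_sym oner_eq0.
    by apply/eqP; rewrite eq_le sched_ge0 andbT leNgt; apply/negP.
  case: b qb => [a qa|]; first by exists a.
  case: q Bqq q1 qB => [[x|E]|] Bqq _ qB qn.
  - by move: qn; rewrite outside_tau ltxx.
  - move/negP: botB; case; apply: qB; apply: state_step_gt0 qn _.
    exact: ltr01.
  - by rewrite Bqq in botB.
pose B := [pred s | Bq (Defs.iota M s)].
(* Enabledness is required separately: an action played at the quotient state of a component may
   belong to another state of that component. *)
pose K s a := enabled M s a &&
  (mec_pair M s a || (0 < sigma (Defs.iota M s) (Some a))).
have [s0 Bs0] : exists s, B s.
  case: q0 Bq0 => [[x|E]|] Bq0.
  - by exists (val x); rewrite /= iota_outside.
  - by have [s sE] := mec_neq0 E; exists s; rewrite /= (iota_mec sE).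
  - by rewrite Bq0 in botB.
apply: (@no_closed_class _ _ _ M B K s0 Bs0).
- move=> s Bs; have [a qa] := actB _ Bs; move: (Bs); rewrite /K /=.
  case: iotaP Bs qa => [x -> _ qa Bx|E sE _ _ BE].
    have /quot_action[u [iu ua _ _]] : enabled MQ (q_outside x) (Some a).
      by apply: (@sched_neq0_enabled _ _ _ _ sigma); rewrite gt_eqF.
    exists a; rewrite qa orbT andbT.
    by move/eqP: iu; rewrite iota_eq_outside => /eqP <-.
  have [b sb] := mec_has_pair sE; have [_ eb _] := mec_pairsP sb.
  by exists b; rewrite eb (mec_pairE _ sE) sb.
- move=> s a Bs /andP[sa pa]; split => // t st.
  have [/existsP[E sE]|npa] := boolP (mec_pair M s a).
    have [sE1 _ h] := mec_pairsP sE.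
    by move: Bs; rewrite /= (iota_mec sE1) (iota_mec (h _ st)).
  rewrite (negbTE npa) /= in pa; have [_ qB] := Babs _ Bs; apply: qB.
  apply: (state_step_gt0 pa).
  have /quot_action[u [iu ua _ ->]] : enabled MQ (Defs.iota M s) (Some a).
    by apply: (@sched_neq0_enabled _ _ _ _ sigma); rewrite gt_eqF.
  rewrite (hdisj ua sa) /trans_iota (bigD1 t) //= ltr_wpDr //.
  by apply: sumr_ge0 => t' _; exact: trans_ge0.
- move=> E s Bs sE; split.
    move=> u a ua; have [uE eua _] := mec_pairsP ua.
    by rewrite /K eua (mec_pairE _ uE) ua.
  have [a qa] := actB _ Bs; move: Bs qa; rewrite /= (iota_mec sE) => BE qa.
  have /quot_action[u [iu ua nua _]] : enabled MQ (q_mec E) (Some a).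
    by apply: (@sched_neq0_enabled _ _ _ _ sigma); rewrite gt_eqF.
  have uE : u \in mec_states E by rewrite -iota_eq_mec iu.
  exists u, a; split => //; first by rewrite -(mec_pairE _ uE).
  by rewrite /K iu ua qa orbT.
Qed.

End quotient.

(** * The lifted scheduler *)

Section uniform_scheduler.
Variables (R : realType) (S A : finType) (M : mdp R S A).
Implicit Types (E : mec M).

(** Outside the maximal end components this is 0 divided by 0, that is 0, so the rows of [mec_step]
    vanish there. *)
Definition mec_uniform (s : S) (a : A) : R :=
  (mec_pair M s a)%:R / (\sum_b mec_pair M s b)%:R.

Definition mec_step (s t : S) : R := \sum_a mec_uniform s a * trans M s a t.

Lemma mec_uniform_ge0 s a : 0 <= mec_uniform s a.
Proof. by rewrite divr_ge0. Qed.

Lemma mec_uniform_gt0 s a : mec_pair M s a -> 0 < mec_uniform s a.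
Proof.
move=> sa; rewrite /mec_uniform sa divr_gt0 ?ltr0n //.
by rewrite (bigD1 a) //= sa.
Qed.

Lemma mec_uniform0 s a : ~~ mec_pair M s a -> mec_uniform s a = 0.
Proof. by rewrite /mec_uniform => /negbTE ->; rewrite mul0r. Qed.

Lemma sum_mec_uniform E s : s \in mec_states E -> \sum_a mec_uniform s a = 1.
Proof.
move=> /mec_has_pair[a sa]; have {}sa : mec_pair M s a by apply/existsP; exists E.
rewrite -mulr_suml -natr_sum divff //.
by rewrite pnatr_eq0 (bigD1 a) //= sa.
Qed.

Lemma mec_pair_enabled s a : mec_pair M s a -> enabled M s a.
Proof. by move=> /existsP[E /mec_pairsP[]]. Qed.

Lemma mec_step_ge0 s t : 0 <= mec_step s t.
Proof.
by apply: sumr_ge0 => a _; rewrite mulr_ge0 ?mec_uniform_ge0 ?trans_ge0.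
Qed.

Lemma sum_mec_step E s : s \in mec_states E -> \sum_t mec_step s t = 1.
Proof.
move=> sE; rewrite exchange_big /= -(sum_mec_uniform sE); apply: eq_bigr => a _.
rewrite -mulr_sumr; have [/mec_pair_enabled/eqP ->|/mec_uniform0 ->] :=
  boolP (mec_pair M s a); by rewrite ?mulr1 ?mul0r.
Qed.

Lemma mec_step_neq0 s t : mec_step s t != 0 ->
  exists E, s \in mec_states E /\ t \in mec_states E.
Proof.
move=> st; apply: contrapT => nE; move/eqP: st; apply; apply: big1 => a _.
have [/existsP[E sa]|/mec_uniform0 ->] := boolP (mec_pair M s a); last first.
  by rewrite mul0r.
have [sE _ h] := mec_pairsP sa.
have [->|t0] := eqVneq (trans M s a t) 0; first by rewrite mulr0.
by case: nE; exists E; split => //; apply: h; rewrite lt_def t0 trans_ge0.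
Qed.

Lemma mec_step_connect E : {in mec_states E &, forall s t,
  connect [rel s t | 0 < mec_step s t] s t}.
Proof.
move=> s t sE tE; apply: connect_sub (mec_connect sE tE) => u v.
move=> /existsP[a /andP[ua uv]]; apply: connect1; rewrite /= /mec_step.
have [uE _ _] := mec_pairsP ua.
rewrite (bigD1 a) //= ltr_wpDr //.
  by apply: sumr_ge0 => b _; rewrite mulr_ge0 ?mec_uniform_ge0 ?trans_ge0.
by rewrite mulr_gt0 // mec_uniform_gt0 // (mec_pairE _ uE).
Qed.

End uniform_scheduler.

(** * The flow in [M] prescribed by the quotient *)

Section lifting.
Variables (R : realType) (S A : finType) (M : mdp R S A).
Hypothesis hdisj : disjoint_actions M.
Variable sigma : scheduler (mec_quotient M).
Hypothesis htau : forall E : mec M,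
  sigma (q_mec E) None = 0 \/ sigma (q_mec E) None = 1.
Variable V : quot_state M -> R.
Hypothesis V_ge0 : forall q, 0 <= V q.
Hypothesis VE : forall q,
  V q = start (mec_quotient M) q + push (state_step sigma) V q.
Implicit Types (E : mec M) (q : quot_state M) (s t u : S) (a : A).

Local Notation iota := (Defs.iota M).
Local Notation MQ := (mec_quotient M).

Lemma q_mec_nonterminal E : ~~ terminal MQ (q_mec E).
Proof.
apply/forallPn; exists None; rewrite negbK.
by apply/eqP; exact: (dirac_distr R (q_bot M)).2.
Qed.

Lemma q_mec_sched_sum E :
  sigma (q_mec E) None + \sum_a sigma (q_mec E) (Some a) = 1.
Proof. by rewrite -sum_option sched_sum // q_mec_nonterminal. Qed.

(* expected frequency in the quotient of the action [a], as an action of [s] *)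
Definition outflow s a : R :=
  if enabled M s a && ~~ mec_pair M s a
  then V (iota s) * sigma (iota s) (Some a) else 0.

Lemma outflow_ge0 s a : 0 <= outflow s a.
Proof. by rewrite /outflow; case: ifP => // _; rewrite mulr_ge0 ?sched_ge0. Qed.

(** By disjointness u is the only state that enables [a], so the sum over the fibre has a single
    nonzero term. *)
Lemma sum_outflow_weighted q a (h : S -> R) u : iota u = q -> enabled M u a ->
  ~~ mec_pair M u a ->
  \sum_(s | iota s == q) outflow s a * h s = V q * sigma q (Some a) * h u.
Proof.
move=> iu ua nu; rewrite (bigD1 u) ?iu //= {1}/outflow ua nu iu big1 ?addr0 //.
move=> s /andP[_ su]; rewrite /outflow; case: ifP => [/andP[sa _]|_].
  by rewrite (hdisj sa ua) eqxx in su.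
by rewrite mul0r.
Qed.

Lemma sum_outflow_trans q a q' :
  \sum_(s | iota s == q) outflow s a * trans_iota s a q' =
  V q * sigma q (Some a) * trans MQ q (Some a) q'.
Proof.
have [q0|/sched_neq0_enabled/quot_action[u [iu ua nu ->]]] :=
  eqVneq (sigma q (Some a)) 0; last exact: sum_outflow_weighted.
rewrite q0 mulr0 mul0r big1 // => s /eqP si; rewrite /outflow si q0 mulr0.
by case: ifP; rewrite mul0r.
Qed.

Lemma sum_outflow q a :
  \sum_(s | iota s == q) outflow s a = V q * sigma q (Some a).
Proof.
have [q0|/sched_neq0_enabled/quot_action[u [iu ua nu _]]] :=
  eqVneq (sigma q (Some a)) 0; last first.
  rewrite -[RHS]mulr1 -(sum_outflow_weighted (fun=> 1) iu ua nu).
  by apply: eq_bigr => s _; rewrite mulr1.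
rewrite q0 mulr0 big1 // => s /eqP si; rewrite /outflow si q0 mulr0.
by case: ifP.
Qed.

(* expected number of times [t] is entered, counting the start in [init M] but
   no transition inside a maximal end component *)
Definition inflow t : R :=
  start M t + \sum_s \sum_a outflow s a * trans M s a t.

(** Summing over a fibre of [iota] turns the inflow into the right-hand side of the flow equation of
    the quotient. The state [q_bot] is excluded because it also receives the flow of tau. *)
Lemma sum_inflow q : q != q_bot M -> \sum_(t | iota t == q) inflow t = V q.
Proof.
move=> qbot; rewrite VE big_split /=; congr (_ + _).
  rewrite /start /=; have [->|qi] := eqVneq q (iota (init M)).
    rewrite (bigD1 (init M)) //= eqxx big1 ?addr0 // => t /andP[_ /negbTE ->] //.
  rewrite big1 // => t /eqP ti; case: eqP => // ei.
  by rewrite -ti ei eqxx in qi.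
transitivity (\sum_s \sum_a outflow s a * trans_iota s a q).
  rewrite exchange_big /=; apply: eq_bigr => s _; rewrite exchange_big /=.
  by apply: eq_bigr => a _; rewrite mulr_sumr.
rewrite (partition_big iota xpredT) //= pushE; apply: eq_bigr => q' _.
rewrite exchange_big /= /state_step sum_option.
have -> : trans MQ q' None q = 0.
  by case: q' => [[x|E]|] //=; rewrite (negbTE qbot).
rewrite mulr0 add0r mulr_sumr; apply: eq_bigr => a _.
by rewrite sum_outflow_trans mulrA.
Qed.

(** The first conjunct excludes components that are never entered: their outflow is zero even if tau
    is not chosen. *)
Definition leaves E := (V (q_mec E) != 0) && (sigma (q_mec E) None == 0).

(** The 0-1 hypothesis on tau enters here: if tau does not have probability 0, it has probability 1
    and no other action is played. *)
Lemma outflow_leaves0 E s a : s \in mec_states E -> ~~ leaves E ->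
  outflow s a = 0.
Proof.
move=> sE; rewrite /leaves /outflow (iota_mec sE) negb_and negbK => nl.
suff -> : V (q_mec E) * sigma (q_mec E) (Some a) = 0 by case: ifP.
case/orP: nl => [/eqP ->|nl]; first by rewrite mul0r.
have s1 : sigma (q_mec E) None = 1 by case: (htau E) nl => -> //; rewrite eqxx.
have /eqP := q_mec_sched_sum E; rewrite s1 addrC -subr_eq0 addrK.
rewrite psumr_eq0 => [/allP/(_ a)|b _]; last exact: sched_ge0.
by rewrite mem_index_enum => /(_ isT)/eqP ->; rewrite mulr0.
Qed.

Lemma sum_mec_outflow E : leaves E ->
  \sum_(s in mec_states E) \sum_a outflow s a = V (q_mec E).
Proof.
move=> /andP[_ /eqP s0]; have := q_mec_sched_sum E; rewrite s0 add0r => s1.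
rewrite exchange_big /= -[RHS]mulr1 -s1 mulr_sumr; apply: eq_bigr => a _.
by rewrite -sum_outflow; apply: eq_bigl => s; rewrite iota_eq_mec.
Qed.

(** If [E] is left, its inflow and its outflow both sum to [V (q_mec E)], so the net inflow sums to
    0 and [poisson_positive] applies to the uniform chain on [E]. *)
Lemma mec_circulation E : exists z : S -> R,
  [/\ forall s, s \notin mec_states E \/ ~~ leaves E -> z s = 0,
      forall s, s \in mec_states E -> leaves E -> 0 < z s &
      forall t, t \in mec_states E -> leaves E ->
        z t + \sum_a outflow t a = inflow t + push (mec_step M) z t].
Proof.
have [lE|nlE] := boolP (leaves E); last first.
  by exists (fun=> 0); split => // *; rewrite ?(negP nlE).
pose d t := if t \in mec_states E then inflow t - \sum_a outflow t a else 0.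
have [|||||||z [z0 z1 z2]] :=
    @poisson_positive R S (mec_states E) (mec_step M) d.
- by have [s sE] := mec_neq0 E; apply/finset.set0Pn; exists s.
- exact: mec_step_ge0.
- exact: sum_mec_step.
- move=> s t sE st; have [E' [sE' tE']] : exists E',
    s \in mec_states E' /\ t \in mec_states E' by apply: mec_step_neq0; rewrite gt_eqF.
  by rewrite (mec_uniq sE sE').
- exact: mec_step_connect.
- by move=> t /negbTE tE; rewrite /d tE.
- rewrite /d -big_mkcond /= sumrB (sum_mec_outflow lE) -(@sum_inflow (q_mec E)) //.
  by apply/eqP; rewrite subr_eq0; apply/eqP; apply: eq_bigl => s; rewrite iota_eq_mec.
exists z; split => [s|s /z1 //|t tE _]; first by case=> [/z0 //|/negP].
by rewrite {1}z2 /d tE; lra.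
Qed.

(** The circulations are added up. Maximal end components share no state and [mec_step] never joins
    two of them, so they do not interfere. *)
Lemma total_circulation : exists z : S -> R,
  [/\ forall s, 0 <= z s, forall E s, s \in mec_states E -> ~~ leaves E -> z s = 0,
      forall s, ~~ in_mec M s -> z s = 0,
      forall E s, s \in mec_states E -> leaves E -> 0 < z s &
      forall E t, t \in mec_states E -> leaves E ->
        z t + \sum_a outflow t a = inflow t + push (mec_step M) z t].
Proof.
have [f fP] := choice mec_circulation.
pose z s := \sum_E f E s.
have zE E s : s \in mec_states E -> z s = f E s.
  move=> sE; rewrite /z (bigD1 E) //= big1 ?addr0 // => E' E'E.
  have [-> //] := fP E'; left.
  by apply: contra E'E => sE'; rewrite (mec_uniq sE sE').
have zl E s : s \in mec_states E -> leaves E -> 0 < z s.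
  by move=> sE lE; rewrite (zE _ _ sE); have [_ + _] := fP E; apply.
have znl E s : s \in mec_states E -> ~~ leaves E -> z s = 0.
  by move=> sE lE; rewrite (zE _ _ sE); have [+ _ _] := fP E; apply; right.
have zout s : ~~ in_mec M s -> z s = 0.
  move=> sM; rewrite /z big1 // => E _; have [+ _ _] := fP E; apply; left.
  by apply: contra sM => sE; apply/existsP; exists E.
exists z; split => // [s|E t tE lE].
  have [/existsP[E sE]|/zout -> //] := boolP (in_mec M s).
  by have [/(zl _ _ sE)/ltW|/(znl _ _ sE) ->] := boolP (leaves E).
rewrite (zE _ _ tE); have [_ _ ->] := fP E => //; congr (_ + _).
rewrite !pushE; apply: eq_bigr => s _.
have [->|/mec_step_neq0[E' [sE' tE']]] := eqVneq (mec_step M s t) 0.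
  by rewrite !mulr0.
by rewrite (zE E) // (mec_uniq tE tE').
Qed.

(** * The scheduler realising the prescribed flow *)

Section lifted_scheduler.
Variable z : S -> R.
Hypothesis z_ge0 : forall s, 0 <= z s.
Hypothesis z_stay : forall E s, s \in mec_states E -> ~~ leaves E -> z s = 0.
Hypothesis z_outside : forall s, ~~ in_mec M s -> z s = 0.
Hypothesis z_leave : forall E s, s \in mec_states E -> leaves E -> 0 < z s.
Hypothesis z_balance : forall E t, t \in mec_states E -> leaves E ->
  z t + \sum_a outflow t a = inflow t + push (mec_step M) z t.

Definition frequency s a : R := z s * mec_uniform M s a + outflow s a.

(** In a component that is not left z is 0, so only entries are counted, as befits a chain that is
    stopped on entering it. *)
Definition visits t : R := inflow t + push (mec_step M) z t.

Lemma frequency_ge0 s a : 0 <= frequency s a.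
Proof. by rewrite addr_ge0 ?outflow_ge0 // mulr_ge0 ?mec_uniform_ge0. Qed.

Lemma frequency_disabled s a : ~~ enabled M s a -> frequency s a = 0.
Proof.
move=> sa; rewrite /frequency /outflow (negbTE sa) addr0 mec_uniform0 ?mulr0 //.
by apply: contra sa; exact: mec_pair_enabled.
Qed.

Lemma visitsE t :
  visits t = start M t + \sum_s \sum_a frequency s a * trans M s a t.
Proof.
rewrite /visits /inflow -addrA; congr (_ + _); rewrite pushE -big_split /=.
apply: eq_bigr => s _; rewrite /mec_step mulr_sumr -big_split /=.
by apply: eq_bigr => a _; rewrite /frequency mulrDl mulrA addrC.
Qed.

Definition quits s : bool := if iota s is Some (inr E) then leaves E else true.

Lemma quits_mec E s : s \in mec_states E -> quits s = leaves E.
Proof. by move=> sE; rewrite /quits (iota_mec sE). Qed.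

Lemma sum_frequency E s : s \in mec_states E -> leaves E ->
  \sum_a frequency s a = visits s.
Proof.
move=> sE lE; rewrite big_split /= -mulr_sumr (sum_mec_uniform sE) mulr1.
exact: z_balance sE lE.
Qed.

Lemma visits_gt0 E s : s \in mec_states E -> leaves E -> 0 < visits s.
Proof.
move=> sE lE; rewrite /visits -(z_balance sE lE) ltr_wpDr ?(z_leave sE) //.
by apply: sumr_ge0 => a _; exact: outflow_ge0.
Qed.

Lemma visits_outside (x : {s | ~~ in_mec M s}) :
  visits (val x) = V (q_outside x).
Proof.
rewrite /visits pushE [X in _ + X]big1 => [|s _]; last first.
  have [->|/mec_step_neq0[E [_ xE]]] := eqVneq (mec_step M s (val x)) 0.
    by rewrite mulr0.
  have /negP[] := valP x; by apply/existsP; exists E.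
rewrite addr0 -sum_inflow // (big_pred1 (val x)) // => s.
exact: iota_eq_outside.
Qed.

(** Outside the components [sigma] is copied instead of dividing by [visits], which may be 0
    there. *)
Definition lifted_sched s a : R :=
  match iota s with
  | Some (inr E) => if leaves E then frequency s a / visits s
                    else mec_uniform M s a
  | q => sigma q (Some a)
  end.

Lemma lifted_sched_ge0 s a : 0 <= lifted_sched s a.
Proof.
rewrite /lifted_sched; case: (iotaP M s) => [x _|E sE] /=; first exact: sched_ge0.
case: ifP => [lE|_]; last exact: mec_uniform_ge0.
by rewrite divr_ge0 ?frequency_ge0 // ltW // (visits_gt0 sE lE).
Qed.

Lemma enabled_outside x a :
  enabled MQ (q_outside x) (Some a) = enabled M (val x) a.
Proof. by rewrite /enabled /= trans_iota_sum. Qed.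

Lemma lifted_sched_enabled s a : ~~ enabled M s a -> lifted_sched s a = 0.
Proof.
move=> sa; rewrite /lifted_sched; case: (iotaP M s) => [x sx|E sE] /=.
  by rewrite sched_enabled // enabled_outside -sx.
rewrite frequency_disabled // mul0r mec_uniform0 ?if_same //.
by apply: contra sa; exact: mec_pair_enabled.
Qed.

Lemma lifted_sched_sum s : ~~ terminal M s -> \sum_a lifted_sched s a = 1.
Proof.
move=> /forallPn[a]; rewrite negbK /lifted_sched.
case: (iotaP M s) => [x ->|E sE] /= xa.
  have <- : \sum_b sigma (q_outside x) b = 1.
    by apply: sched_sum; apply/forallPn; exists (Some a); rewrite negbK enabled_outside.
  by rewrite sum_option outside_tau add0r.
case: (boolP (leaves E)) => lE; last exact: sum_mec_uniform sE.
by rewrite -mulr_suml (sum_frequency sE lE) divff // gt_eqF // (visits_gt0 sE lE).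
Qed.

Definition theta : scheduler M :=
  Scheduler lifted_sched_ge0 lifted_sched_enabled lifted_sched_sum.

(** Outside the components the circulation vanishes and [visits] is [V]; in a component that is left
    the division by [visits] cancels; in any other one circulation and outflow are both 0. *)
Lemma frequencyE s a : frequency s a = (quits s)%:R * (visits s * theta s a).
Proof.
rewrite /= /quits /lifted_sched; case: (iotaP M s) => [x sx|E sE] /=.
  rewrite mul1r /frequency z_outside; last by rewrite sx; exact: valP x.
  rewrite mul0r add0r /outflow sx visits_outside iota_outside.
  rewrite mec_pair_outside ?andbT; last exact: valP x.
  by case: ifP => // /negbT xa; rewrite sched_enabled ?mulr0 // enabled_outside.
case: (boolP (leaves E)) => lE.
  by rewrite mul1r mulrC divfK // gt_eqF // (visits_gt0 sE lE).
by rewrite /frequency (z_stay sE lE) (outflow_leaves0 _ sE lE) !mul0r addr0.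
Qed.

(* The chain of theta, stopped once it reaches an end component that is never
   left. *)
Definition stopped_step s t : R := (quits s)%:R * state_step theta s t.

Lemma stopped_step_substochastic : substochastic stopped_step.
Proof.
have [Q0 Q1] := state_step_substochastic theta.
split=> [s t|s]; first by rewrite mulr_ge0.
rewrite -mulr_sumr; case: (quits s); first by rewrite mul1r.
by rewrite mul0r.
Qed.

Lemma visits_stopped t : visits t = start M t + push stopped_step visits t.
Proof.
rewrite visitsE; congr (_ + _); rewrite pushE; apply: eq_bigr => s _.
rewrite /stopped_step /state_step mulrCA mulrA mulr_sumr.
by apply: eq_bigr => a _; rewrite frequencyE !mulrA.
Qed.

(** An absorbing class meets only components that are left. There [theta] plays every internal pair,
    as z is positive, and some outgoing action, as [V] is nonzero and tau is not chosen;
    [no_closed_class] concludes. *)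
Lemma stopped_step_transient : transient stopped_step.
Proof.
move=> B Babs s0 Bs0.
have Bquits s : B s -> quits s.
  move=> /Babs[+ _]; rewrite -mulr_sumr; case: (quits s) => //.
  by rewrite mul0r => /eqP; rewrite eq_sym oner_eq0.
apply: (@no_closed_class _ _ _ M B (fun s a => 0 < theta s a) s0 Bs0).
- move=> s Bs; have [+ _] := Babs _ Bs.
  rewrite -mulr_sumr Bquits // mul1r sum_state_step => s1.
  apply: contrapT => /forallNP na; move/eqP: s1; rewrite big1 => [|a _].
    by rewrite eq_sym oner_eq0.
  by apply/eqP; rewrite eq_le sched_ge0 andbT leNgt; apply/negP.
- move=> s a Bs sa; split.
    by apply: (@sched_neq0_enabled _ _ _ _ theta); rewrite gt_eqF.
  move=> t st; have [_] := Babs _ Bs; apply.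
  by rewrite /stopped_step Bquits // mul1r (state_step_gt0 sa).
- move=> E s Bs sE; have lE : leaves E by rewrite -(quits_mec sE) Bquits.
  have freq_theta u a : u \in mec_states E -> 0 < frequency u a -> 0 < theta u a.
    move=> uE ua; rewrite lt_def sched_ge0 andbT.
    by apply: contraTneq ua => u0; rewrite frequencyE u0 !mulr0 ltxx.
  split=> [u a ua|].
    have [uE _ _] := mec_pairsP ua; apply: freq_theta => //.
    rewrite ltr_wpDr ?outflow_ge0 // mulr_gt0 ?(z_leave uE) //.
    by rewrite mec_uniform_gt0 // (mec_pairE _ uE).
  have /andP[V0 /eqP s0E] := lE.
  have [a sa] : exists a, sigma (q_mec E) (Some a) != 0.
    apply: contrapT => /forallNP na; have := q_mec_sched_sum E.
    rewrite s0E add0r big1 => [/eqP|a _]; first by rewrite eq_sym oner_eq0.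
    by apply/eqP; apply: contrapT => /negP; exact: na.
  have [u [iu ua nu _]] := quot_action (sched_neq0_enabled sa).
  have uE : u \in mec_states E by rewrite -iota_eq_mec iu.
  exists u, a; split; rewrite -?(mec_pairE _ uE) //; apply: freq_theta => //.
  rewrite /frequency ltr_wpDl ?mulr_ge0 ?mec_uniform_ge0 //.
  by rewrite /outflow ua nu iu lt_def mulf_neq0 //= mulr_ge0 ?sched_ge0.
Qed.

(** In a component that is not left, [theta] plays internal pairs only. The mass kept there by the
    unstopped chain thus never returns to a state satisfying [quits]. *)
Lemma iter_stopped n t : quits t ->
  iter n (push (state_step theta)) (start M) t =
  iter n (push stopped_step) (start M) t.
Proof.
elim: n t => // n IH t qt; rewrite !iterS !pushE; apply: eq_bigr => s _.
rewrite /stopped_step; case: (boolP (quits s)) => [qs|]; first by rewrite IH // mul1r.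
rewrite mul0r mulr0 {1}/quits /state_step /= /lifted_sched.
case: (iotaP M s) => //= E sE /negbTE nlE.
rewrite nlE -/(mec_step M s t).
have [->|/mec_step_neq0[E' [sE' tE']]] := eqVneq (mec_step M s t) 0.
  by rewrite mulr0.
by move: qt; rewrite (quits_mec tE') -(mec_uniq sE sE') nlE.
Qed.

(** An action outside all components has weight 0 in [mec_uniform], so [theta] plays it only at
    states satisfying [quits], where the stopped chain gives the correct visits. *)
Lemma theta_frequency a : (forall E, a \notin mec_actions E) ->
  expected_frequency sigma (Some a) = expected_frequency theta a.
Proof.
move=> nmec; have nu s : mec_uniform M s a = 0.
  apply: mec_uniform0; apply/negP => /existsP[E sa].
  by have /negP[] := nmec E; rewrite inE; apply/existsP; exists s.
have theta_quits s : theta s a != 0 -> quits s.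
  rewrite /= /lifted_sched /quits; case: (iotaP M s) => //= E sE.
  by case: ifP => // _; rewrite nu eqxx.
rewrite (expected_frequency_limit (v := V)) => [|q _]; last first.
  apply: (transient_series (state_step_substochastic _) _ _ VE).
    exact: quotient_transient.
  exact: start_ge0.
rewrite (expected_frequency_limit (v := visits)) => [|s sa]; last first.
  under eq_fun do under eq_bigr do rewrite iter_stopped ?theta_quits //.
  apply: (transient_series stopped_step_substochastic stopped_step_transient _
    visits_stopped).
  exact: start_ge0.
(* Both frequencies equal the total outflow through [a]: on the quotient side by summing over
   fibres, on the side of [theta] because the circulation puts nothing on [a]. *)
congr _%:E; transitivity (\sum_s outflow s a).
  rewrite (partition_big iota xpredT) //=; apply: eq_bigr => q _.
  by rewrite sum_outflow.
apply: eq_bigr => s _; have := frequencyE s a.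
rewrite {1}/frequency nu mulr0 add0r => ->.
have [-> |/theta_quits ->] := eqVneq (theta s a) 0; first by rewrite !mulr0.
by rewrite mul1r.
Qed.

End lifted_scheduler.
End lifting.

Theorem theorem4p19 (R : realType) (S A : finType) (M : mdp R S A)
    (hdisj : disjoint_actions M)
    (sigma : scheduler (mec_quotient M))
    (htau : forall E : mec M,
       sigma (q_mec E) None = 0 \/ sigma (q_mec E) None = 1) :
  exists theta : scheduler M,
    forall a : A, (forall E : mec M, a \notin mec_actions E) ->
      expected_frequency sigma (Some a) = expected_frequency theta a.
Proof.
have sQ := state_step_substochastic sigma.
have tQ := quotient_transient hdisj (sigma := sigma).
have [V VE] := transient_solve (start (mec_quotient M)) sQ tQ.
have V_ge0 := transient_solution_ge0 sQ tQ (@start_ge0 _ _ _ _) VE.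
have [z [z0 z1 z2 z3 z4]] := total_circulation hdisj VE.
exists (theta V_ge0 z0 z3 z4) => a na.
exact: theta_frequency.
Qed.
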